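(* If $\mathfrak{c}$ is not a Kunen cardinal, then there exists a uniform Eberlein compact space $K$ such that the Banach space $C(K)$ embeds isomorphically into $\ell_\infty/c_0$ and does not embed isometrically into $\ell_\infty/c_0$.
   Context: $\mathfrak{c}=2^{\aleph_0}$. For a compact space $K$, $C(K)$ is the Banach space of continuous real-valued functions on $K$ with the supremum norm. $\ell_\infty/c_0$ is the quotient Banach space of bounded real sequences modulo sequences converging to $0$, with norm $\|[x]\|=\limsup_n |x(n)|$. A Banach space $X$ embeds isomorphically into a Banach space $Y$ if there is a linear map $T:X\to Y$ that is an isomorphism (linear homeomorphism) onto its image $T(X)$; it embeds isometrically if there is a linear (not necessarily surjective) isometry $X\to Y$. A compact space is uniform Eberlein if it is homeomorphic to a subset of a Hilbert space equipped with its weak topology; equivalently, if it embeds, for some index set $\Gamma$, into $B(\Gamma)=\{x\in[-1,1]^\Gamma:\sum_{\gamma\in\Gamma}|x_\gamma|\leqslant 1\}$ with the product topology. For a set $\Gamma$, $\mathcal{P}^2(\Gamma)$ is the $\sigma$-field of subsets of $\Gamma\times\Gamma$ generated by the sets $A_1\times A_2$ with $A_1,A_2\subseteq\Gamma$ arbitrary. A cardinal $\kappa$ is Kunen if $\mathcal{P}(\kappa\times\kappa)=\mathcal{P}^2(\kappa)$, i.e. every subset of $\kappa\times\kappa$ belongs to $\mathcal{P}^2(\kappa)$. *)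

(* Defs.v *)
From HB Require Import structures.
From mathcomp Require Import all_boot all_order all_algebra.
From mathcomp Require Import sesquilinear generic_quotient ring_quotient.
From mathcomp Require Import all_classical all_reals all_analysis.

Set Implicit Arguments.
Unset Strict Implicit.
Unset Printing Implicit Defensive.

Import Order.TTheory GRing.Theory Num.Theory.
Import numFieldNormedType.Exports.

Local Open Scope classical_set_scope.
Local Open Scope quotient_scope.
Local Open Scope ring_scope.

Definition square_sigma_field (T : Type) : set (set (T * T)) :=
  <<s [set A1 `*` A2 | A1 in [set: set T] & A2 in [set: set T]] >>.

(* A cardinal is represented by any type of that cardinality. *)
Definition kunen (T : Type) : Prop :=
  forall A : set (T * T), square_sigma_field A.

(* `subspace (range f)` carries the relative topology on `range f`, so this
   says that f is a homeomorphism onto its image. *)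
Definition topological_embedding (X Y : topologicalType) (f : X -> Y) : Prop :=
  [/\ injective f, continuous f &
      forall U : set X, open U -> open (f @` U : set (subspace (range f)))].

Definition isomorphically_embeds (R : realType) (X Y : normedModType R) : Prop :=
  exists T : {linear X -> Y}, topological_embedding T.

Definition isometrically_embeds (R : realType) (X Y : normedModType R) : Prop :=
  exists T : {linear X -> Y}, forall x, `|T x| = `|x|.

Definition continuous_dual (R : realType) (V : normedModType R) : Type :=
  {phi : {linear V -> R} | continuous phi}.

Definition weak_space (R : realType) (V : normedModType R) : topologicalType :=
  sup_topology (fun phi : continuous_dual V =>
    Topological.on (initial_topology (sval phi : V -> R))).

(* A real Hilbert space is a complete normed space H whose norm comes from an
   inner product. *)
Definition hilbert_inner_product (R : realType) (H : completeNormedModType R)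
    (ip : {dot H for idfun}) : Prop :=
  forall x : H, ip x x = `|x| ^+ 2.

(* Meant for compact K. Such a K is Hausdorff, as weak topologies are. *)
Definition uniform_eberlein (R : realType) (K : topologicalType) : Prop :=
  exists (H : completeNormedModType R) (ip : {dot H for idfun}),
    hilbert_inner_product ip /\
    exists f : K -> weak_space H, topological_embedding f.

Section continuous_functions.
Variables (R : realType) (K : topologicalType).

Definition continuous_pred : {pred K -> R} := mem [set f | continuous f].

Lemma continuous_submod_closed : submod_closed continuous_pred.
Proof.
split=> [|a f g]; rewrite !inE /=; first by move=> x; exact: cst_continuous.
by move=> cf cg x; apply: cvgD; [apply: cvgZr; exact: cf|exact: cg].
Qed.

HB.instance Definition _ :=
  GRing.isSubmodClosed.Build R (K -> R) continuous_pred continuous_submod_closed.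

Record cfun := CFun { cfun_val :> K -> R ; _ : cfun_val \in continuous_pred }.

HB.instance Definition _ := [isSub for cfun_val].
HB.instance Definition _ := [Choice of cfun by <:].
HB.instance Definition _ := [SubChoice_isSubLmodule of cfun by <:].

Lemma cfun_continuous (f : cfun) : continuous f.
Proof. by case: f => f /=; rewrite inE. Qed.

End continuous_functions.

(* The sup norm on the continuous functions is finite by compactness, whence
   the proof argument. *)
Definition CK (R : realType) (K : topologicalType) (_ : compact [set: K]) : Type :=
  cfun R K.

Section CK_normed.
Variables (R : realType) (K : topologicalType) (cK : compact [set: K]).

HB.instance Definition _ := GRing.Lmodule.on (CK R cK).

Definition sup_norm (f : CK R cK) : R := sup (range (fun x => `|f x|)).

Lemma sup_norm_bounded (f : CK R cK) : has_ubound (range (fun x => `|f x|)).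
Proof.
have /compact_bounded[M [Mr MP]] : compact (range (f : K -> R)).
  apply: continuous_compact => //; apply: continuous_subspaceT.
  exact: (@cfun_continuous R K f).
exists (M + 1) => _ [x _ <-]; have := MP (M + 1); rewrite ltrDl ltr01.
by apply=> //; exists x.
Qed.

Lemma sup_norm_ub (f : CK R cK) x : `|f x| <= sup_norm f.
Proof. by apply: (ub_le_sup (sup_norm_bounded f)); exists x. Qed.

Lemma sup_norm_ge0 (f : CK R cK) : 0 <= sup_norm f.
Proof.
have [f0|/set0P[_ [x _ _]]] := eqVneq (range (fun x => `|f x|)) set0.
  by rewrite /sup_norm f0 sup0.
exact: le_trans (sup_norm_ub f x).
Qed.

Lemma sup_norm_le (f : CK R cK) (M : R) :
  0 <= M -> (forall x, `|f x| <= M) -> sup_norm f <= M.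
Proof.
move=> M0 fM; rewrite /sup_norm.
have [->|/set0P ne] := eqVneq (range (fun x => `|f x|)) set0.
  by rewrite sup0.
by apply: ge_sup => // _ [x _ <-]; exact: fM.
Qed.

Lemma sup_normD (f g : CK R cK) : sup_norm (f + g) <= sup_norm f + sup_norm g.
Proof.
apply: sup_norm_le => [|x]; first by rewrite addr_ge0// sup_norm_ge0.
by apply: (le_trans (ler_normD (f x) (g x))); rewrite lerD// sup_norm_ub.
Qed.

Lemma sup_normZ (a : R) (f : CK R cK) : sup_norm (a *: f) = `|a| * sup_norm f.
Proof.
have le_normZ b g : sup_norm (b *: g) <= `|b| * sup_norm g.
  apply: sup_norm_le => [|x]; first by rewrite mulr_ge0// sup_norm_ge0.
  by rewrite [leLHS](normrM b (g x)) ler_wpM2l// sup_norm_ub.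
apply/eqP; rewrite eq_le le_normZ /=.
have [->|a0] := eqVneq a 0; first by rewrite normr0 mul0r sup_norm_ge0.
by rewrite -ler_pdivlMl ?normr_gt0// -normfV -{1}(scalerK a0 f) le_normZ.
Qed.

Lemma sup_norm_eq0 (f : CK R cK) : sup_norm f = 0 -> f = 0.
Proof.
move=> f0; apply/val_inj/funext => x; apply/eqP; rewrite -normr_le0.
by have := sup_norm_ub f x; rewrite f0.
Qed.

HB.instance Definition _ :=
  Lmodule_isNormed.Build R (CK R cK) sup_normD sup_normZ sup_norm_eq0.

End CK_normed.

Section bounded_sequences.
Variable R : realType.

Definition bounded_pred : {pred nat -> R} := mem bounded_fun.

Lemma bounded_predP (u : nat -> R) :
  u \in bounded_pred <-> exists M, forall n, `|u n| <= M.
Proof.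
have ? : ProperFilter (globally [set: nat]) by exact: (@globally_properfilter _ _ 0).
rewrite inE /= (@ex_bound _ _ _ u (globally setT)).
by split=> -[M uM]; exists M => n; [exact: uM|move=> _; exact: uM].
Qed.

Lemma bounded_submod_closed : submod_closed bounded_pred.
Proof.
split=> [|a u v]; last move=> /bounded_predP[M uM] /bounded_predP[N vN].
  by apply/bounded_predP; exists 0 => n; rewrite normr0.
apply/bounded_predP; exists (`|a| * M + N) => n.
rewrite (le_trans (ler_normD _ _))// lerD// [leLHS](normrM a (u n)).
exact: ler_wpM2l.
Qed.

HB.instance Definition _ :=
  GRing.isSubmodClosed.Build R (nat -> R) bounded_pred bounded_submod_closed.

Record linf := Linf { linf_val :> nat -> R ; _ : linf_val \in bounded_pred }.

HB.instance Definition _ := [isSub for linf_val].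
HB.instance Definition _ := [Choice of linf by <:].
HB.instance Definition _ := [SubChoice_isSubLmodule of linf by <:].

Lemma linf_bounded (u : linf) : exists M, forall n, `|u n| <= M.
Proof. by case: u => u /= /bounded_predP. Qed.

Definition c0_pred : {pred linf} := mem [set u : linf | u @ \oo --> (0 : R)].

Lemma c0_submod_closed : submod_closed c0_pred.
Proof.
split=> [|a u v]; rewrite !inE /=; first exact: cvg_cst.
move=> cu cv; have := cvgD (cvgM (cvg_cst a) cu) cv.
by rewrite mulr0 addr0; apply.
Qed.

HB.instance Definition _ :=
  GRing.isSubmodClosed.Build R linf c0_pred c0_submod_closed.

Lemma c0_predP (u : linf) : reflect (u @ \oo --> (0 : R)) (u \in c0_pred).
Proof. by apply: (iffP idP); rewrite inE. Qed.

Definition limsup_norm (u : linf) : R := limn_sup (fun n => `|u n|).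

Lemma limsup_norm_cvg (u : linf) :
  sups (fun n => `|u n|) @ \oo --> limsup_norm u.
Proof.
have [M uM] := linf_bounded u.
have ub : has_ubound (range (fun n => `|u n|)) by exists M => _ [n _ <-].
have lb : has_lbound (range (fun n => `|u n|)) by exists 0 => _ [n _ <-].
by have cu := cvg_sups_inf ub lb; apply/cvg_ex; eexists; exact: cu.
Qed.

Lemma limsup_norm_lt (u : linf) (e : R) :
  limsup_norm u < e -> \forall n \near \oo, `|u n| < e.
Proof.
have [M uM] := linf_bounded u; have cu := @limsup_norm_cvg u.
move=> /(cvgr_lt _ cu); apply: filterS => n; apply: le_lt_trans.
apply: ub_le_sup; last by exists n => /=.
by exists M => _ [k _ <-].
Qed.

Lemma limsup_norm_le (u : linf) (e : R) :
  (\forall n \near \oo, `|u n| <= e) -> limsup_norm u <= e.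
Proof.
have cu := @limsup_norm_cvg u; move=> [N _ uN].
rewrite -(cvg_lim (@Rhausdorff R) cu).
apply: limr_le; first by apply/cvg_ex; exists (limsup_norm u).
exists N => // n /= Nn; apply: ge_sup; first by exists `|u n|, n => /=.
by move=> _ [k /= nk <-]; apply: uN; exact: leq_trans nk.
Qed.

Lemma limsup_normD (u v : linf) :
  limsup_norm (u + v) <= limsup_norm u + limsup_norm v.
Proof.
apply/ler_addgt0Pr => e e0; apply: limsup_norm_le.
have e20 : 0 < e / 2 by rewrite divr_gt0.
have := limsup_norm_lt (u := u) (e := limsup_norm u + e / 2).
have := limsup_norm_lt (u := v) (e := limsup_norm v + e / 2).
rewrite !ltrDl => /(_ e20) + /(_ e20); apply: filterS2 => n vn un.
rewrite [e]splitr addrACA (le_trans (ler_normD (u n) (v n)))//.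
by rewrite lerD// ltW.
Qed.

Lemma limsup_norm_ge0 (u : linf) : 0 <= limsup_norm u.
Proof.
rewrite leNgt; apply/negP => /limsup_norm_lt[N _ /(_ N (leqnn N))] /=.
by rewrite ltNge normr_ge0.
Qed.

Lemma limsup_normZ (a : R) (u : linf) :
  limsup_norm (a *: u) = `|a| * limsup_norm u.
Proof.
have le_normZ b w : limsup_norm (b *: w) <= `|b| * limsup_norm w.
  apply/ler_addgt0Pr => e e0; apply: limsup_norm_le.
  have b0 : 0 < `|b| + 1 by rewrite ltr_wpDl.
  have := limsup_norm_lt (u := w) (e := limsup_norm w + e / (`|b| + 1)).
  rewrite ltrDl divr_gt0// => /(_ isT); apply: filterS => n wn.
  rewrite [leLHS](normrM b (w n)) (le_trans (ler_wpM2l _ (ltW wn)))//.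
  by rewrite mulrDr lerD2l mulrCA -[leRHS]mulr1 ler_pM2l// ler_pdivrMr// mul1r
    lerDl.
apply/eqP; rewrite eq_le le_normZ /=.
have [->|a0] := eqVneq a 0; first by rewrite normr0 mul0r limsup_norm_ge0.
by rewrite -ler_pdivlMl ?normr_gt0// -normfV -{1}(scalerK a0 u) le_normZ.
Qed.

Lemma limsup_norm_eq0 (u : linf) : (limsup_norm u == 0) = (u \in c0_pred).
Proof.
apply/eqP/c0_predP => [u0|cu].
  apply/cvgr0Pnorm_lt => e e0; apply: limsup_norm_lt; by rewrite u0.
apply/eqP; rewrite eq_le limsup_norm_ge0 andbT; apply/ler_addgt0Pr => e e0.
by rewrite add0r; apply: limsup_norm_le; move/cvgr0Pnorm_le : cu => /(_ e e0).
Qed.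

Definition linf_c0 : Type := Quotient.quot c0_pred.

HB.instance Definition _ := Choice.on linf_c0.
HB.instance Definition _ := GRing.Zmodule.on linf_c0.

Definition linf_c0_class (u : linf) : linf_c0 := \pi_(Quotient.quot c0_pred) u.

Definition linf_c0_scale (a : R) (x : linf_c0) : linf_c0 :=
  linf_c0_class (a *: repr x).

Definition linf_c0_norm (x : linf_c0) : R := limsup_norm (repr x).

Lemma linf_c0_classP (u v : linf) :
  linf_c0_class u = linf_c0_class v <-> u - v \in c0_pred.
Proof. by rewrite Quotient.idealrBE; split=> /eqP. Qed.

Lemma linf_c0_reprK (x : linf_c0) : linf_c0_class (repr x) = x.
Proof. exact: reprK. Qed.

Lemma linf_c0_classD (u v : linf) :
  linf_c0_class (u + v) = linf_c0_class u + linf_c0_class v.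
Proof. by rewrite /linf_c0_class !piE. Qed.

Lemma linf_c0_class_scale (a : R) (u : linf) :
  linf_c0_class (a *: u) = linf_c0_scale a (linf_c0_class u).
Proof.
apply/linf_c0_classP; rewrite -scalerBr rpredZ//.
by apply/linf_c0_classP; rewrite linf_c0_reprK.
Qed.

Lemma linf_c0_scaleA a b x :
  linf_c0_scale a (linf_c0_scale b x) = linf_c0_scale (a * b) x.
Proof.
by rewrite -[x]linf_c0_reprK -!linf_c0_class_scale scalerA.
Qed.

Lemma linf_c0_scale1 : left_id 1 linf_c0_scale.
Proof. by move=> x; rewrite -[x]linf_c0_reprK -linf_c0_class_scale scale1r. Qed.

Lemma linf_c0_scaleDr : right_distributive linf_c0_scale +%R.
Proof.
move=> a x y; rewrite -[x]linf_c0_reprK -[y]linf_c0_reprK.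
by rewrite -linf_c0_classD -!linf_c0_class_scale scalerDr linf_c0_classD.
Qed.

Lemma linf_c0_scaleDl x : {morph linf_c0_scale^~ x : a b / a + b}.
Proof.
move=> a b /=; rewrite -[x]linf_c0_reprK -!linf_c0_class_scale scalerDl.
exact: linf_c0_classD.
Qed.

HB.instance Definition _ := GRing.Zmodule_isLmodule.Build R linf_c0
  linf_c0_scaleA linf_c0_scale1 linf_c0_scaleDr linf_c0_scaleDl.

Lemma linf_c0_class_is_linear : linear linf_c0_class.
Proof. by move=> a u v; rewrite linf_c0_classD linf_c0_class_scale. Qed.

HB.instance Definition _ :=
  GRing.isLinear.Build R linf linf_c0 _ linf_c0_class linf_c0_class_is_linear.

Lemma linf_c0_normE (u : linf) : linf_c0_norm (linf_c0_class u) = limsup_norm u.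
Proof.
have le_norm v w : v - w \in c0_pred -> limsup_norm v <= limsup_norm w.
  rewrite -limsup_norm_eq0 => /eqP vw.
  by have := limsup_normD (v - w) w; rewrite subrK vw add0r.
have : repr (linf_c0_class u) - u \in c0_pred.
  by apply/linf_c0_classP; rewrite linf_c0_reprK.
move=> ru; apply/eqP; rewrite eq_le !le_norm//.
by rewrite -opprB rpredN.
Qed.

Lemma linf_c0_normD x y :
  linf_c0_norm (x + y) <= linf_c0_norm x + linf_c0_norm y.
Proof.
rewrite -[x]linf_c0_reprK -[y]linf_c0_reprK -linf_c0_classD !linf_c0_normE.
exact: limsup_normD.
Qed.

Lemma linf_c0_normZ a x : linf_c0_norm (a *: x) = `|a| * linf_c0_norm x.
Proof.
by rewrite -[x]linf_c0_reprK -linearZ !linf_c0_normE limsup_normZ.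
Qed.

Lemma linf_c0_norm_eq0 x : linf_c0_norm x = 0 -> x = 0.
Proof.
rewrite -[x]linf_c0_reprK linf_c0_normE => /eqP; rewrite limsup_norm_eq0 => x0.
rewrite -[RHS](linear0 linf_c0_class).
by apply/linf_c0_classP; rewrite subr0.
Qed.

HB.instance Definition _ := Lmodule_isNormed.Build R linf_c0
  linf_c0_normD linf_c0_normZ linf_c0_norm_eq0.

End bounded_sequences.

(* Main.v *)
(* Let A be a subset of Gamma x Gamma outside P^2(Gamma), where
   Gamma = {0,1}^nat, seen as the edge set of a bipartite graph on two copies of
   Gamma. Take for K the set of all edges, together with the singletons and the
   empty set, as a subspace of the weak topology of l2 of the vertices (a set is
   the sum of the basis vectors of its elements).

   C(K) is isomorphic to a subspace of c_0(K): the Moebius transform of a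
   continuous function over the inclusion order of K, which has order at most 2,
   vanishes at infinity. As |K| is at most the continuum, c_0(K) embeds
   isometrically into l_infty/c_0 by an almost disjoint family of branches.

   A linear isometry of C(K) would send the coordinate functions to classes of
   bounded sequences u_a and v_b, such that limsup |u_a(n) + v_b(n)| is 2 when
   (a, b) is in A and at most 1 otherwise. The set of pairs (a, b) such that
   |u_a(n) + v_b(n)| > c belongs to P^2(Gamma) for all n and c; so would A. *)

Require Import Defs.
From HB Require Import structures.
From mathcomp Require Import all_boot all_order all_algebra finmap.
From mathcomp Require Import sesquilinear.
From mathcomp Require Import all_classical all_reals all_analysis.
From mathcomp Require Import measurable_realfun.
From mathcomp Require Import ring lra zify.

Set Implicit Arguments.
Unset Strict Implicit.
Unset Printing Implicit Defensive.

Import Order.TTheory GRing.Theory Num.Theory.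
Import numFieldNormedType.Exports.

Local Open Scope classical_set_scope.
Local Open Scope ring_scope.

(** * The Hilbert space l2(I) *)

Section finite_subsets_filter.
Variable I : choiceType.

(** Limits along this filter are unordered sums over [I], which may be uncountable. *)
Definition fset_filter : set_system {fset I} :=
  filter_from [set: {fset I}] (fun s => [set t | (s `<=` t)%fset]).

Lemma fset_filter_proper : ProperFilter fset_filter.
Proof.
apply: filter_from_proper; last by move=> s _; exists s => /=.
apply: filter_from_filter; first by exists fset0.
move=> s t _ _; exists (s `|` t)%fset => // r /= str; split => /=.
  exact: (fsubset_trans (fsubsetUl _ _) str).
exact: (fsubset_trans (fsubsetUr _ _) str).
Qed.

End finite_subsets_filter.

Arguments fset_filter : clear implicits.

#[global] Existing Instance fset_filter_proper.

Section nonneg_sums.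
Variables (R : realType) (I : choiceType).

Lemma ler_fsum_subset (a : I -> R) (s t : {fset I}) : (forall i, 0 <= a i) ->
  (s `<=` t)%fset -> \sum_(i <- s) a i <= \sum_(i <- t) a i.
Proof.
move=> a0 st; rewrite [leRHS](big_fsetID _ (mem s))/=.
rewrite [X in _ <= X + _](_ : _ = \sum_(i <- s) a i).
  by rewrite lerDl sumr_ge0.
congr bigop; apply: f_equal; apply/fsetP => i; rewrite !inE/=.
by case: (boolP (i \in s)) => [/(fsubsetP st)->|]; rewrite ?andbF.
Qed.

Lemma fsum_cvg_sup (a : I -> R) (M : R) : (forall i, 0 <= a i) ->
  (forall s : {fset I}, \sum_(i <- s) a i <= M) ->
  (fun s : {fset I} => \sum_(i <- s) a i) @ fset_filter I -->
    sup (range (fun s : {fset I} => \sum_(i <- s) a i)).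
Proof.
move=> a0 aM; set S := range _.
have supS : has_sup S.
  split; first by exists (\sum_(i <- fset0) a i), fset0.
  by exists M => _ [s _ <-].
apply/cvgrPdist_lt => e e0; have [_ [s _ <-] se] := sup_adherent e0 supS.
exists s => // t /= st; rewrite ger0_norm ?subr_ge0.
  by rewrite ltrBlDl -ltrBlDr (lt_le_trans se)// ler_fsum_subset.
by apply: ub_le_sup => //; [case: supS|exists t].
Qed.

End nonneg_sums.

Section l2.
Variables (R : realType) (I : choiceType).

Definition l2_pred : {pred I -> R} :=
  mem [set u : I -> R |
    exists M, forall s : {fset I}, \sum_(i <- s) u i ^+ 2 <= M].

Lemma l2_predP (u : I -> R) : u \in l2_pred <->
  exists M, forall s : {fset I}, \sum_(i <- s) u i ^+ 2 <= M.
Proof. by rewrite inE. Qed.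

Lemma l2_submod_closed : submod_closed l2_pred.
Proof.
split=> [|a u v]; last move=> /l2_predP[M uM] /l2_predP[N vN].
  apply/l2_predP; exists 0 => s.
  by rewrite big1// => i _; rewrite /= expr0n.
apply/l2_predP; exists (2 * a ^+ 2 * M + 2 * N) => s.
apply: (@le_trans _ _ (2 * a ^+ 2 * \sum_(i <- s) u i ^+ 2 +
                       2 * \sum_(i <- s) v i ^+ 2)).
  rewrite !mulr_sumr -big_split/=; apply: ler_sum => i _.
  rewrite [X in X ^+ 2 <= _](_ : _ = a * u i + v i)// -subr_ge0.
  by rewrite (_ : _ - _ = (a * u i - v i) ^+ 2) ?sqr_ge0//; ring.
by rewrite lerD ?ler_wpM2l// mulr_ge0// sqr_ge0.
Qed.

HB.instance Definition _ :=
  GRing.isSubmodClosed.Build R (I -> R) l2_pred l2_submod_closed.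

Record l2 := L2 { l2_val :> I -> R ; _ : l2_val \in l2_pred }.

HB.instance Definition _ := [isSub for l2_val].
HB.instance Definition _ := [Choice of l2 by <:].
HB.instance Definition _ := [SubChoice_isSubLmodule of l2 by <:].

Lemma l2_bounded (u : l2) :
  exists M, forall s : {fset I}, \sum_(i <- s) u i ^+ 2 <= M.
Proof. by case: u => u /= /l2_predP. Qed.

Lemma l2DE (u v : l2) i : (u + v) i = u i + v i. Proof. by []. Qed.
Definition l2_psum (u v : l2) (s : {fset I}) : R := \sum_(i <- s) u i * v i.

Definition l2_ip (u v : l2) : R := lim (l2_psum u v @ fset_filter I).

Lemma l2_psum_sqr_cvg (u : l2) :
  cvg (l2_psum u u @ fset_filter I).
Proof.
have [M uM] := l2_bounded u; apply/cvg_ex; eexists.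
apply: (@fsum_cvg_sup _ _ (fun i => u i * u i) M) => //.
by move=> i; rewrite -expr2 sqr_ge0.
Qed.

(** By polarization the partial sums are combinations of sums of squares, which converge as bounded
    increasing nets. *)
Lemma l2_ip_cvg (u v : l2) : l2_psum u v @ fset_filter I --> l2_ip u v.
Proof.
suff : cvg (l2_psum u v @ fset_filter I) by [].
have -> : l2_psum u v =
    2^-1 \*o ((l2_psum (u + v) (u + v) \- l2_psum u u) \- l2_psum v v).
  apply/funext => s /=; rewrite /l2_psum -!sumrB mulr_sumr.
  by apply: eq_bigr => i _; rewrite !l2DE; field.
apply/cvg_ex; eexists; apply: cvgM; first exact: cvg_cst.
by apply: cvgB; [apply: cvgB|]; exact: l2_psum_sqr_cvg.
Qed.

Lemma l2_ipE (u v : l2) l : l2_psum u v @ fset_filter I --> l -> l2_ip u v = l.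
Proof. by move=> /(cvg_lim (@Rhausdorff R)). Qed.

Lemma l2_ipC u v : l2_ip u v = l2_ip v u.
Proof.
rewrite /l2_ip (_ : l2_psum u v = l2_psum v u)//.
by apply/funext => s; apply: eq_bigr => i _; rewrite mulrC.
Qed.

Lemma l2_ip_linear v : linear_for *%R (l2_ip ^~ v).
Proof.
move=> a u w; apply: l2_ipE.
have -> : l2_psum (a *: u + w) v = (a \*o l2_psum u v) \+ l2_psum w v.
  apply/funext => s /=; rewrite /l2_psum mulr_sumr -big_split.
  by apply: eq_bigr => i _; rewrite [LHS]mulrDl mulrA.
by apply: cvgD; [apply: cvgM (cvg_cst _) _|]; exact: l2_ip_cvg.
Qed.

Lemma l2_ip_linearr v : linear_for *%R (l2_ip v).
Proof. by move=> a u w; rewrite !(l2_ipC v) l2_ip_linear. Qed.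

Lemma l2_ip_bilinear : bilinear_for *%R (idfun \; *%R) l2_ip.
Proof. by split; [exact: l2_ip_linear|exact: l2_ip_linearr]. Qed.

HB.instance Definition _ :=
  bilinear_isBilinear.Build R l2 l2 R _ _ l2_ip l2_ip_bilinear.

Lemma le_l2_psum (u : l2) s : l2_psum u u s <= l2_ip u u.
Proof.
have cu := @l2_psum_sqr_cvg u.
apply: limr_ge => //; exists s => // t /= st.
by apply: ler_fsum_subset => // i; rewrite -expr2 sqr_ge0.
Qed.

Lemma l2_ip_le (u : l2) (M : R) :
  (forall s, l2_psum u u s <= M) -> l2_ip u u <= M.
Proof.
by move=> uM; apply: limr_le; [exact: l2_psum_sqr_cvg|exists fset0].
Qed.

Lemma l2_ip_ge0 (u : l2) : 0 <= l2_ip u u.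
Proof. by have := le_l2_psum u fset0; rewrite /l2_psum big_nil. Qed.

Lemma sqr_le_l2_ip (u : l2) i : u i ^+ 2 <= l2_ip u u.
Proof.
by have := le_l2_psum u [fset i]%fset; rewrite /l2_psum big_seq_fset1 expr2.
Qed.

Lemma l2_ip_eq0 (u : l2) : l2_ip u u = 0 -> u = 0.
Proof.
move=> u0; apply/val_inj/funext => i; apply/eqP; rewrite -sqrf_eq0.
by rewrite eq_le sqr_ge0 andbT -u0 sqr_le_l2_ip.
Qed.

Lemma l2_ip_gt0 (u : l2) : u != 0 -> 0 < l2_ip u u.
Proof.
move=> u0; rewrite lt_neqAle l2_ip_ge0 andbT eq_sym.
by apply: contra u0 => /eqP/l2_ip_eq0 ->.
Qed.

Lemma l2_ip_hermitian (u v : l2) :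
  l2_ip u v = (-1) ^+ false * idfun (l2_ip v u).
Proof. by rewrite expr0 mul1r /= l2_ipC. Qed.

HB.instance Definition _ :=
  @isHermitianSesquilinear.Build R l2 false idfun l2_ip l2_ip_hermitian.
HB.instance Definition _ := @isDotProduct.Build R l2 l2_ip l2_ip_gt0.

Lemma l2_ipDl (u v w : l2) : l2_ip (u + v) w = l2_ip u w + l2_ip v w.
Proof. exact: linearDl. Qed.

Lemma l2_ipZl a (u w : l2) : l2_ip (a *: u) w = a * l2_ip u w.
Proof. exact: linearZl_LR. Qed.

Lemma l2_ip_sqrD (u v : l2) :
  l2_ip (u + v) (u + v) = l2_ip u u + 2 * l2_ip u v + l2_ip v v.
Proof.
rewrite l2_ipDl (l2_ipC u (u + v)) (l2_ipC v (u + v)) !l2_ipDl (l2_ipC v u).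
by ring.
Qed.

Lemma l2_ip_sqrZ a (u : l2) : l2_ip (a *: u) (a *: u) = a ^+ 2 * l2_ip u u.
Proof. by rewrite l2_ipZl l2_ipC l2_ipZl mulrA expr2. Qed.

Lemma l2_cauchy_schwarz (u v : l2) : l2_ip u v ^+ 2 <= l2_ip u u * l2_ip v v.
Proof.
have [->|v0] := eqVneq v 0; first by rewrite !linear0r expr0n.
(* Up to the factor [l2_ip v v], this vector is the component of [u] orthogonal to [v]; its square
   is that factor times the difference of the two sides. *)
have := l2_ip_ge0 (l2_ip v v *: u + (- l2_ip u v) *: v).
rewrite l2_ip_sqrD !l2_ip_sqrZ l2_ipZl [l2_ip u (_ *: v)]l2_ipC l2_ipZl
  (l2_ipC v u).
move: (l2_ip_gt0 v0) => vv0.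
set a := l2_ip u u; set b := l2_ip v v in vv0 *; set c := l2_ip u v.
rewrite (_ : _ + _ = b * (a * b - c ^+ 2)); last by ring.
by rewrite pmulr_rge0// subr_ge0.
Qed.

Definition l2_norm (u : l2) : R := Num.sqrt (l2_ip u u).

Lemma l2_normD (u v : l2) : l2_norm (u + v) <= l2_norm u + l2_norm v.
Proof.
rewrite -ler_sqr ?nnegrE ?addr_ge0 ?sqrtr_ge0// sqrrD !sqr_sqrtr ?l2_ip_ge0//.
rewrite l2_ip_sqrD lerD2r lerD2l mulr_natl ler_wMn2r// -sqrtrM ?l2_ip_ge0//.
by rewrite (le_trans (ler_norm _))// -sqrtr_sqr ler_wsqrtr// l2_cauchy_schwarz.
Qed.

Lemma l2_normZ a (u : l2) : l2_norm (a *: u) = `|a| * l2_norm u.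
Proof. by rewrite /l2_norm l2_ip_sqrZ sqrtrM ?sqr_ge0// sqrtr_sqr. Qed.

Lemma l2_norm_eq0 (u : l2) : l2_norm u = 0 -> u = 0.
Proof.
move/eqP; rewrite sqrtr_eq0 => u0; apply: l2_ip_eq0.
by apply/eqP; rewrite eq_le u0 l2_ip_ge0.
Qed.

HB.instance Definition _ :=
  Lmodule_isNormed.Build R l2 l2_normD l2_normZ l2_norm_eq0.

Lemma l2_norm_sqr (u : l2) : l2_ip u u = `|u| ^+ 2.
Proof. by rewrite [X in _ = X ^+ 2]/(l2_norm u) sqr_sqrtr// l2_ip_ge0. Qed.

Lemma le_l2_norm (u : l2) i : `|u i| <= `|u|.
Proof.
by rewrite -ler_sqr ?nnegrE// -l2_norm_sqr real_normK ?num_real// sqr_le_l2_ip.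
Qed.

(** Let [u] be the coordinatewise limit. Bounds on finite partial sums of [(x - v) ^+ 2] pass to the
    limit in [v]; they put [x - u], hence [u], in l2, and then give convergence in norm. *)
Lemma l2_complete (F : set_system l2) : ProperFilter F -> cauchy F -> cvg F.
Proof.
move=> FF /cauchyP Fc.
have [u Fu] : exists u : I -> R, forall i, (fun v : l2 => v i) @ F --> u i.
  suff /choice[u Fu] : forall i, exists l, (fun v : l2 => v i) @ F --> (l : R).
    by exists u.
  move=> i; apply/cvg_ex; apply: cauchy_cvg; apply: cauchy_exP => e e0.
  have [x Fx] := Fc e e0; exists (x i);
    apply: (@filterS _ F _ (ball x e)) => // v.
  rewrite -ball_normE; apply: le_lt_trans; exact: (le_l2_norm (x - v)).
have le_u x e : 0 < e -> F (ball x e) ->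
    forall s : {fset I}, \sum_(i <- s) (x i - u i) ^+ 2 <= e ^+ 2.
  move=> e0 Fx s.
  have cv : (fun v : l2 => \sum_(i <- s) (x i - v i) ^+ 2) @ F -->
      \sum_(i <- s) (x i - u i) ^+ 2.
    apply: (@cvg_big R I +%R 0 xpredT (@add_continuous R) _ F s
      (fun i (v : l2) => (x i - v i) ^+ 2)) => i _.
    have cv : (fun v : l2 => x i - v i) @ F --> x i - u i.
      by apply: cvgB (Fu i); exact: cvg_cst.
    exact: (cvgM cv cv).
  rewrite -(cvg_lim (@Rhausdorff R) cv); apply: limr_le.
    by apply/cvg_ex; eexists; exact: cv.
  apply: filterS Fx => v; rewrite -ball_normE/= => xv.
  have := le_l2_psum (x - v) s; rewrite l2_norm_sqr => /le_trans; apply.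
  by rewrite ler_sqr ?nnegrE ?(ltW e0)// ltW.
have uP : u \in l2_pred.
  have [x Fx] := Fc 1 ltr01.
  have xu : (x : I -> R) - u \in l2_pred.
    by apply/l2_predP; exists (1 ^+ 2) => s; exact: le_u Fx s.
  have := rpredB (valP x) xu; rewrite opprB addrC subrK.
  by apply.
apply/cvg_ex; exists (L2 uP); apply/cvgrPdist_lt => e e0.
have e20 : 0 < e / 2 by rewrite divr_gt0.
have [x Fx] := Fc _ e20.
apply: (@filterS _ F _ (ball x (e / 2))) => // v; rewrite -ball_normE/= => xv.
rewrite (splitr e) -(subrKA x) (le_lt_trans (ler_normD _ _))// ler_ltD//.
rewrite distrC -ler_sqr ?nnegrE ?(ltW e20)// -l2_norm_sqr l2_ip_le// => s.
exact: le_u Fx s.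
Qed.

HB.instance Definition _ := Uniform_isComplete.Build l2 l2_complete.

End l2.

Lemma finite_near_forall (T J : Type) (F : set_system T) (S : set J)
    (P : J -> set T) : Filter F -> finite_set S ->
  (forall j, S j -> F (P j)) -> F [set t | forall j, S j -> P j t].
Proof.
move=> FF; have [E|/set0P[j0 _]] := eqVneq S set0.
  by rewrite E => _ _; apply: filterS filterT => t _ j [].
move=> /(@finite_seqP {classic J})[s ->] {S}.
elim: s => [|j s ih] FP; first by apply: filterS filterT => t _ k.
have Fj : F (P j) by apply: FP; rewrite /= mem_head.
have Fs : F [set t | forall k, [set` s] k -> P k t].
  by apply: ih => k ks; apply: FP; rewrite /= inE; apply/orP; right.
apply: filterS2 Fj Fs => t Pj Ps k; rewrite /= inE => /orP[/eqP->//|ks].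
exact: Ps.
Qed.

(** * Continuous functionals on l2(I) *)

Section l2_dual.
Variables (R : realType) (I : choiceType).
Local Notation H := (l2 R I).

Definition l2_coord (i : I) (u : H) : R := u i.

Lemma l2_coord_linear i : linear (l2_coord i).
Proof. by []. Qed.

HB.instance Definition _ i :=
  GRing.isLinear.Build R H R _ (l2_coord i) (l2_coord_linear i).

Lemma l2_coord_continuous i : continuous (l2_coord i).
Proof.
apply/linear_bounded_continuous/linear_boundedP; exists 1; split=> // r r1 u.
by rewrite (le_trans (le_l2_norm u i))// ler_peMl// ltW.
Qed.

Lemma l2_single_subproof i : (fun j => (j == i)%:R) \in @l2_pred R I.
Proof.
apply/l2_predP; exists 1 => s.
have [si|si] := boolP (i \in s).
  rewrite (big_fsetD1 i)//= eqxx expr1n big1_seq ?addr0// => j.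
  by rewrite !inE => /andP[_ /andP[/negPf->]]; rewrite expr0n.
rewrite big1_seq ?ler01// => j /andP[_ js].
by have [ji|] := eqVneq j i; [rewrite -ji js in si|rewrite expr0n].
Qed.

Definition l2_single i : H := L2 (l2_single_subproof i).

Lemma l2_ip_single i (u : H) : l2_ip (l2_single i) u = u i.
Proof.
apply: l2_ipE; apply: cvg_near_cst; exists [fset i]%fset => // s /=.
rewrite fsub1set => si; rewrite /l2_psum (big_fsetD1 i)//= eqxx mul1r.
rewrite big1_seq ?addr0// => j.
by rewrite !inE => /andP[_ /andP[/negPf->]]; rewrite mul0r.
Qed.

(* No Riesz representation is needed: evaluate phi at
   [\sum_(i <- s) phi e_i *: e_i]. *)
Lemma l2_bessel (phi : {linear H -> R}) : continuous phi ->
  exists C, forall s : {fset I}, \sum_(i <- s) phi (l2_single i) ^+ 2 <= C.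
Proof.
move=> phic;
  have [C C0 phiC] : exists2 C, 0 < C & forall u, `|phi u| <= C * `|u|.
  have /linear_boundedP/pinfty_ex_gt0[C C0 phiC] :=
    continuous_linear_bounded 0 (phic 0).
  by exists C.
exists (C ^+ 2) => s; set Q := \sum_(i <- s) _.
pose v : H := \sum_(i <- s) phi (l2_single i) *: l2_single i.
have vE i : i \in s -> v i = phi (l2_single i).
  move=> si; transitivity (\sum_(j <- s) phi (l2_single j) * (i == j)%:R).
    by rewrite -[v i]/(l2_coord i v) linear_sum.
  rewrite (big_fsetD1 i)//= eqxx mulr1 big1_seq ?addr0// => j.
  by rewrite !inE eq_sym => /andP[_ /andP[/negPf->]]; rewrite mulr0.
have phiv : phi v = Q.
  by rewrite linear_sum; apply: eq_bigr => i _; rewrite linearZ expr2.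
have vv : `|v| ^+ 2 = Q.
  rewrite -l2_norm_sqr {2}/v linear_sumr /Q !big_seq; apply: eq_bigr => i si.
  by rewrite linearZr_LR/= l2_ipC l2_ip_single vE// expr2.
have Q0 : 0 <= Q by rewrite -vv sqr_ge0.
have := phiC v; rewrite phiv ger0_norm// => Qv.
have : Q ^+ 2 <= C ^+ 2 * Q.
  by rewrite -vv -exprMn vv ler_sqr ?nnegrE// mulr_ge0// ltW.
have [->|Qn0] := eqVneq Q 0; first by rewrite sqr_ge0.
by rewrite expr2 ler_pM2r// lt_neqAle eq_sym Qn0.
Qed.

Lemma l2_dual_finite (phi : {linear H -> R}) (e : R) : continuous phi ->
  0 < e -> finite_set [set i | e <= `|phi (l2_single i)|].
Proof.
move=> /l2_bessel[C phiC] e0; apply: contrapT.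
(* More than [C / e ^+ 2] indices, each contributing at least [e ^+ 2], would exceed the bound [C]
   on the sums of squares. *)
move=> /(infinite_set_fset (Num.truncn (C / e ^+ 2)).+1)[s sE sn].
have := phiC s; apply/negP; rewrite -ltNge.
have : C < (Num.truncn (C / e ^+ 2)).+1%:R * e ^+ 2.
  by rewrite -ltr_pdivrMr ?exprn_gt0// truncnS_gt.
move=> /lt_le_trans; apply.
apply: (@le_trans _ _ (\sum_(i <- s) e ^+ 2)).
  rewrite big_const_seq iter_addr_0 count_predT -[leRHS]mulr_natl.
  by rewrite ler_wpM2r ?sqr_ge0// ler_nat.
rewrite !big_seq; apply: ler_sum => i si.
rewrite -[leRHS]real_normK ?num_real// ler_sqr ?nnegrE ?(ltW e0)//.
by have := sE i; rewrite /= si; exact.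
Qed.


End l2_dual.

(** * The compact space of a bipartite graph *)

Lemma cvg_initial_topology (S : choiceType) (T : topologicalType) (f : S -> T)
    (F : set_system S) (x : S) : Filter F ->
  f @ F --> f x -> F --> (x : initial_topology f).
Proof.
move=> FF fF U; rewrite (@nbhsE (initial_topology f)) => -[_ [[V oV <-] Vx] VU].
by apply: filterS VU _; apply: fF; exact: open_nbhs_nbhs.
Qed.

(** In the second case [f] leaves every finite set along [F], which is convergence to the point at
    infinity of discrete [U]. *)
Lemma ultra_fiber (T U : Type) (F : set_system T) (f : T -> U) :
  UltraFilter F ->
  (exists u, F [set t | f t = u]) \/ (forall u, F [set t | f t <> u]).
Proof.
move=> FU; have [|nF] := pselect (exists u, F [set t | f t = u]); first by left.
right=> u; have [Fu|//] := in_ultra_setVsetC [set t | f t = u] FU.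
by exfalso; apply: nF; exists u.
Qed.

Section bipartite_compactum.
Variables (R : realType) (G : choiceType) (A : set (G * G)).

(* The empty set, the singletons and the edges of the bipartite graph [A] on two
   copies of [G]. *)
Definition edge_pred (p : option G * option G) : bool :=
  match p with (Some a, Some b) => `[< A (a, b) >] | _ => true end.

Definition edges := {p | edge_pred p}.

Definition o2vec (b : bool) (o : option G) : l2 R (bool * G)%type :=
  if o is Some a then l2_single R (b, a) else 0.

Definition edge_vec (x : edges) : weak_space (l2 R (bool * G)%type) :=
  o2vec true (val x).1 + o2vec false (val x).2.

Definition edge_space := initial_topology edge_vec.

Definition proj1e (x : edges) := (val x).1.
Definition proj2e (x : edges) := (val x).2.

(* [lim F = o] in the one-point compactification of the discrete space [G],
   whose point at infinity is [None]. *)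
Definition ocvg (F : set_system (option G)) (o : option G) :=
  if o is Some a then F [set Some a] else forall a, F (~` [set Some a]).

Lemma ultra_ocvg (F : set_system edges) (f : edges -> option G) :
  UltraFilter F -> exists o, ocvg (f @ F) o.
Proof.
move=> FU; have [[[a|] Fa]|Fn] := ultra_fiber f FU; first by exists (Some a).
  by exists None => a; apply: (@filterS _ F _ _ _ _ Fa) => x /= ->.
by exists None => a; exact: (Fn (Some a)).
Qed.

(** A function vanishing at infinity, extended by 0 at [None], is continuous on the one-point
    compactification. *)
Lemma ocvg_cvg (F : set_system (option G)) (c : G -> R) (o : option G) :
  Filter F -> (forall e, 0 < e -> finite_set [set a | e <= `|c a|]) ->
  ocvg F o -> oapp c 0 o' @[o' --> F] --> oapp c 0 o.
Proof.
move=> FF c0; case: o => [a|] Fo.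
  by apply: cvg_near_cst; apply: filterS Fo => _ ->.
apply/cvgr0Pnorm_lt => e e0.
have := finite_near_forall FF (c0 _ e0) (fun a _ => Fo a).
apply: filterS => -[a /= Fa|_]; last by rewrite normr0.
by rewrite ltNge; apply/negP => /Fa.
Qed.

(** Weak convergence is tested on each functional [phi]. Its value at [edge_vec y] is a sum of two
    terms, each depending on one vertex of [y] only, and the coefficients of [phi] vanish at
    infinity. *)
Lemma cvg_edge_space (F : set_system edges) (x : edges) : Filter F ->
  ocvg (proj1e @ F) (proj1e x) -> ocvg (proj2e @ F) (proj2e x) ->
  F --> (x : edge_space).
Proof.
move=> FF F1 F2; apply: cvg_initial_topology.
apply/cvg_sup => -[phi phic] /=; apply: cvg_initial_topology.
have phiE b o : phi (o2vec b o) = oapp (fun a => phi (l2_single R (b, a))) 0 o.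
  by case: o => //=; rewrite linear0.
have phi0 b e : 0 < e -> finite_set [set a | e <= `|phi (l2_single R (b, a))|].
  move=> e0;
    apply: (@sub_finite_set _ _ (snd @` [set i | e <= `|phi (l2_single R i)|])).
    by move=> a ea; exists (b, a).
  by apply: finite_image; exact: l2_dual_finite.
have -> :
  phi (edge_vec x) = phi (o2vec true (proj1e x)) + phi (o2vec false (proj2e x)).
  by rewrite -linearD.
have -> : phi @ (edge_vec @ F) =
    (fun y => phi (o2vec true (proj1e y)) + phi (o2vec false (proj2e y))) @ F.
  by congr (fmap _ F); apply/funext => y /=; rewrite -linearD.
rewrite !phiE; under eq_fun do rewrite !phiE.
apply: cvgD.
  exact: (@ocvg_cvg (proj1e @ F) _ _ _ (phi0 true) F1).
exact: (@ocvg_cvg (proj2e @ F) _ _ _ (phi0 false) F2).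
Qed.

(** Only a pair of two vertices is constrained. In that case some point of [edges] has exactly these
    two coordinates, so that the pair is an edge. *)
Lemma edge_pred_ultra (F : set_system edges) (o1 o2 : option G) :
  UltraFilter F -> ocvg (proj1e @ F) o1 -> ocvg (proj2e @ F) o2 ->
  edge_pred (o1, o2).
Proof.
move=> FU; case: o1 o2 => [a|//] [b|//] F1 F2.
have F12 : F [set x | proj1e x = Some a /\ proj2e x = Some b].
  exact: (@filterI _ F _ _ _ F1 F2).
have [x [<- <-]] := filter_ex F12.
by have := valP x; rewrite /proj1e /proj2e; case: (val x).
Qed.

Lemma edge_space_compact : compact [set: edge_space].
Proof.
rewrite compact_ultra => F FU _.
have [u1 F1] := ultra_ocvg proj1e FU; have [u2 F2] := ultra_ocvg proj2e FU.
exists (exist _ (u1, u2) (edge_pred_ultra FU F1 F2)); split => //.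
by apply: (@cvg_edge_space F (exist _ (u1, u2) _) _ F1 F2).
Qed.

Lemma edge_vecE (x : edges) i : (edge_vec x : l2 R (bool * G)%type) i =
  (if i.1 then proj1e x == Some i.2 else proj2e x == Some i.2)%:R.
Proof.
have o2vecE b o : o2vec b o i = ((b == i.1) && (o == Some i.2))%:R.
  case: o => [a|]; last by rewrite andbF.
  by case: i => c d;
    rewrite [LHS]/((_ == (b, a))%:R) xpair_eqE eq_sym [d == a]eq_sym.
rewrite [LHS](congr2 +%R (o2vecE true _) (o2vecE false _)) /proj1e /proj2e.
by case: i.1; rewrite /= ?addr0 ?add0r.
Qed.

Lemma edge_vec_inj : injective edge_vec.
Proof.
move=> x y xy; have E b a := congr1 (fun v : l2 _ _ => v (b, a)) xy.
apply: val_inj; rewrite [val x]surjective_pairing [val y]surjective_pairing.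
have oE (o o' : option G) :
    (forall a, (o == Some a)%:R = (o' == Some a)%:R :> R) -> o = o'.
  case: o o' => [a|] [a'|] // => [/(_ a)|/(_ a)|/(_ a')]; rewrite eqxx.
  - by case: eqP => [->|_ /eqP]; rewrite // oner_eq0.
  - by move/eqP; rewrite oner_eq0.
  - by move/eqP; rewrite eq_sym oner_eq0.
congr (_, _); apply: oE => a.
  by have := E true a; rewrite !edge_vecE.
by have := E false a; rewrite !edge_vecE.
Qed.

Lemma edge_space_uniform_eberlein : uniform_eberlein R edge_space.
Proof.
exists (l2 R (bool * G)%type), (@l2_ip R (bool * G)%type); split.
  by move=> u; exact: l2_norm_sqr.
exists edge_vec; split;
  [exact: edge_vec_inj|exact: (@initial_continuous _ _ edge_vec)|].
(* Open sets are preimages of weakly open [V], and the image of such a preimage is the trace of [V]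
   on the range. *)
move=> _ [V oV <-]; apply/open_subspaceP; exists V => //.
apply/seteqP; split=> y.
  by move=> [Vy [x xT xy]]; split; exists x => //; rewrite /= xy.
by move=> [[x /= Vx <-] yT].
Qed.

End bipartite_compactum.

(** * The Moebius transform on K *)

Section moebius.
Variables (R : realType) (G : choiceType) (A : set (G * G)).
Local Notation E := (edges A).
Local Notation K := (edge_space R A).

Definition edge_bot : E := exist (@edge_pred G A) (None, None) isT.

Lemma edge_pred1 (o : option G) : edge_pred A (o, None). Proof. by case: o. Qed.

(** As a set, [retr1 x] is the part of [x] in the first copy of [G], and [retr2 x] the part in the
    second; both stay in K because K is closed under subsets. *)
Definition retr1 (x : E) : E :=
  exist (@edge_pred G A) (proj1e x, None) (edge_pred1 (proj1e x)).
Definition retr2 (x : E) : E :=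
  exist (@edge_pred G A) (None, proj2e x) isT.

(* Moebius inversion over the sets contained in [x]. Unlike [f], its Moebius
   transform belongs to c_0 when [f] is continuous. *)
Definition moebius (f : E -> R) (x : E) : R :=
  f x - (isSome (proj1e x))%:R * f (retr2 x)
      - (isSome (proj2e x))%:R * f (retr1 x)
      + (isSome (proj1e x) && isSome (proj2e x))%:R * f edge_bot.

Lemma moebiusP a (f g : E -> R) x :
  moebius (fun y => a * f y + g y) x = a * moebius f x + moebius g x.
Proof. by rewrite /moebius; ring. Qed.

Lemma norm_bool_mulr_le (b : bool) (y M : R) : `|y| <= M -> `|b%:R * y| <= M.
Proof.
by case: b => yM; rewrite ?mul1r// mul0r normr0 (le_trans _ yM).
Qed.

(** The constant 4 is the largest number of subsets of a point of K, here and in the inversion. *)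
Lemma moebius_le (f : E -> R) M x :
  (forall y, `|f y| <= M) -> `|moebius f x| <= 4 * M.
Proof.
move=> fM; rewrite /moebius (_ : 4 * M = M + M + M + M); last by ring.
do 3 rewrite (le_trans (ler_normD _ _))// ?normrN ?lerD ?norm_bool_mulr_le//.
Qed.

(** The value of [f] at [x] is the sum of its transform over the subsets of [x]. The Booleans tell
    which vertices [x] has, so that no subset is counted twice. *)
Lemma moebius_inv (f : E -> R) x : exists b1 b2 : bool,
  f x = moebius f x + b1%:R * moebius f (retr2 x) + b2%:R * moebius f (retr1 x)
    + (b1 && b2)%:R * moebius f edge_bot.
Proof.
exists (isSome (proj1e x)), (isSome (proj2e x)).
have r22 : retr2 (retr2 x) = retr2 x by [].
have r11 : retr1 (retr1 x) = retr1 x by [].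
have r12 : retr1 (retr2 x) = edge_bot by exact: val_inj.
have r21 : retr2 (retr1 x) = edge_bot by exact: val_inj.
rewrite /moebius /= r12 r21 -[proj1e (retr1 x)]/(proj1e x)
  -[proj2e (retr2 x)]/(proj2e x).
by case: (isSome (proj1e x)); case: (isSome (proj2e x)); rewrite /=; ring.
Qed.

Lemma moebius_inv_le (f : E -> R) M x :
  (forall y, `|moebius f y| <= M) -> `|f x| <= 4 * M.
Proof.
move=> fM; have [b1 [b2 ->]] := moebius_inv f x.
rewrite (_ : 4 * M = M + M + M + M); last by ring.
do 3 rewrite (le_trans (ler_normD _ _))// ?lerD ?norm_bool_mulr_le//.
Qed.

Lemma ocvg_cst_None (T : Type) (F : set_system T) : Filter F ->
  ocvg ((fun _ : T => @None G) @ F) None.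
Proof. by move=> FF a; apply: (@filterS _ F _ setT) => //; exact: filterT. Qed.

(** As the first vertex goes to infinity, [x] and [retr2 x] approach the same point, while [retr1 x]
    approaches the empty set; the four terms of the transform cancel in pairs. *)
Lemma moebius_cvg0_1 (f : E -> R) (F : set_system E) (e : R) :
  continuous (f : K -> R) -> UltraFilter F ->
  (forall o, F [set x | proj1e x <> o]) -> 0 < e ->
  F [set x | `|moebius f x| < e].
Proof.
move=> fc FU F1 e0; have FF : Filter F by apply: filter_filter.
have [u F2] := ultra_ocvg (@proj2e G A) FU.
pose x0 : E := exist (@edge_pred G A) (None, u) isT.
have e20 : 0 < e / 2 by rewrite divr_gt0.
have F1N : ocvg (@proj1e G A @ F) None by move=> a; exact: (F1 (Some a)).
have Fx0 : F --> (x0 : K) by apply: cvg_edge_space.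
have Fr2 : @retr2 @ F --> (x0 : K).
  apply: cvg_edge_space => //; exact: ocvg_cst_None.
have Fr1 : @retr1 @ F --> (edge_bot : K).
  apply: cvg_edge_space => //; exact: ocvg_cst_None.
have f0 : f @ F --> f x0
  by exact: (@continuous_cvg E K R F _ idfun f _ (fc x0) Fx0).
have f2 : f \o @retr2 @ F --> f x0
  by exact: (@continuous_cvg E K R F _ (@retr2) f _ (fc x0) Fr2).
have f1 : f \o @retr1 @ F --> f edge_bot
  by exact: (@continuous_cvg E K R F _ (@retr1) f _ (fc edge_bot) Fr1).
have H0 : (fun x => f x - f (retr2 x)) @ F --> (0 : R).
  by rewrite -(subrr (f x0)); exact: cvgB.
have {H0}H1 := (@cvgr0Pnorm_lt R R E F FF _).1 H0 _ e20.
have H2 := (@cvgrPdist_lt R R E F FF _ _).1 f1 _ e20.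
have H := @filterI E F FF _ _ (F1 None) (@filterI E F FF _ _ H1 H2).
apply: (@filterS E F FF _ _ _ H) => x [/= + [/=]].
rewrite /moebius.
(* [F1 None] guarantees a first vertex, so that [f (retr2 x)] has coefficient 1. *)
case: (proj1e x) => // a _ {}H1 {}H2 /=.
rewrite (_ : _ + _ = (f x - f (retr2 x)) +
  (isSome (proj2e x))%:R * (f edge_bot - f (retr1 x))); last by ring.
by rewrite (le_lt_trans (ler_normD _ _))// (splitr e) ltr_leD//
  norm_bool_mulr_le// ltW.
Qed.

Lemma moebius_cvg0_2 (f : E -> R) (F : set_system E) (e : R) :
  continuous (f : K -> R) -> UltraFilter F ->
  (forall o, F [set x | proj2e x <> o]) -> 0 < e ->
  F [set x | `|moebius f x| < e].
Proof.
move=> fc FU F2 e0; have FF : Filter F by apply: filter_filter.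
have [u F1] := ultra_ocvg (@proj1e G A) FU.
pose x0 : E := exist (@edge_pred G A) (u, None) (edge_pred1 u).
have e20 : 0 < e / 2 by rewrite divr_gt0.
have F2N : ocvg (@proj2e G A @ F) None by move=> a; exact: (F2 (Some a)).
have Fx0 : F --> (x0 : K) by apply: cvg_edge_space.
have Fr1 : @retr1 @ F --> (x0 : K).
  apply: cvg_edge_space => //; exact: ocvg_cst_None.
have Fr2 : @retr2 @ F --> (edge_bot : K).
  apply: cvg_edge_space => //; exact: ocvg_cst_None.
have f0 : f @ F --> f x0
  by exact: (@continuous_cvg E K R F _ idfun f _ (fc x0) Fx0).
have f1 : f \o @retr1 @ F --> f x0
  by exact: (@continuous_cvg E K R F _ (@retr1) f _ (fc x0) Fr1).
have f2 : f \o @retr2 @ F --> f edge_bot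
  by exact: (@continuous_cvg E K R F _ (@retr2) f _ (fc edge_bot) Fr2).
have H0 : (fun x => f x - f (retr1 x)) @ F --> (0 : R).
  by rewrite -(subrr (f x0)); exact: cvgB.
have {H0}H1 := (@cvgr0Pnorm_lt R R E F FF _).1 H0 _ e20.
have H2 := (@cvgrPdist_lt R R E F FF _ _).1 f2 _ e20.
have H := @filterI E F FF _ _ (F2 None) (@filterI E F FF _ _ H1 H2).
apply: (@filterS E F FF _ _ _ H) => x [/= + [/=]].
rewrite /moebius.
case: (proj2e x) => // a _ {}H1 {}H2; rewrite /= andbT.
rewrite (_ : _ + _ = (f x - f (retr1 x)) +
  (isSome (proj1e x))%:R * (f edge_bot - f (retr2 x))); last by ring.
by rewrite (le_lt_trans (ler_normD _ _))// (splitr e) ltr_leD//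
  norm_bool_mulr_le// ltW.
Qed.

(** An infinite level set would carry an ultrafilter containing no finite set. If one vertex escapes
    along it, the transform tends to 0; if both are eventually constant, it contains a set with at
    most one point. *)
Lemma moebius_c0 (f : E -> R) (e : R) : continuous (f : K -> R) -> 0 < e ->
  finite_set [set x | e <= `|moebius f x|].
Proof.
move=> fc e0; apply: contrapT; set S := [set x | _] => infS.
have FF :
  ProperFilter (filter_from [set B : set E | finite_set B] (fun B => S `\` B)).
  apply: filter_from_proper; last first.
    move=> B fB; apply/set0P/negP => /eqP; rewrite setD_eq0 => SB.
    exact/infS/(sub_finite_set SB).
  apply: filter_from_filter; first by exists set0; exact: finite_set0.
  move=> B C fB fC; exists (B `|` C); first by rewrite /= finite_setU; split.
  by move=> x [Sx nBC]; split; split=> //; apply: contra_not nBC; [left|right].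
have [F [FU sF]] := ultraFilterLemma FF.
have FS : F S by apply: sF; exists set0; [exact: finite_set0|move=> x []].
have Ffin B : finite_set B -> ~ F B.
  move=> fB FB; have FnB : F (~` B) by apply: sF; exists B => // x [].
  by have [x []] := filter_ex (filterI FB FnB).
have FnS : ~ F [set x | `|moebius f x| < e].
  move=> FnS; have [x [/= Sx]] := filter_ex (filterI FS FnS).
  by rewrite ltNge Sx.
have [[u1 F1]|/(moebius_cvg0_1 fc FU)/(_ e0)//] := ultra_fiber (@proj1e G A) FU.
have [[u2 F2]|/(moebius_cvg0_2 fc FU)/(_ e0)//] := ultra_fiber (@proj2e G A) FU.
apply: (Ffin ([set x | proj1e x = u1] `&` [set x | proj2e x = u2]));
  last exact: filterI.
have [x0 [x01 x02]] := filter_ex (filterI F1 F2).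
apply: (sub_finite_set _ (finite_set1 x0)) => x [/= x1 x2]; apply: val_inj.
rewrite [LHS]surjective_pairing [RHS]surjective_pairing.
by congr (_, _);
  [rewrite -[LHS]/(proj1e x) x1 -x01|rewrite -[LHS]/(proj2e x) x2 -x02].
Qed.

Lemma edge_coord_continuous i :
  continuous (fun x : K => l2_coord i (edge_vec R x : l2 R (bool * G)%type)).
Proof.
pose H := l2 R (bool * G)%type.
pose phi : continuous_dual H :=
  exist (fun phi : {linear H -> R} => continuous phi) (l2_coord i)
    (@l2_coord_continuous R _ i).
move=> x; have /cvg_sup cx := @initial_continuous _ _ (edge_vec R (A := A)) x.
apply: (@continuous_cvg K (initial_topology (sval phi)) R (nbhs x) _
  (edge_vec R (A := A)) (sval phi)); first exact: initial_continuous.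
apply: (cx _ phi); exact/fmap_filter/(nbhs_filter (x : K)).
Qed.

Lemma proj1e_continuous a :
  continuous (fun x : K => (proj1e x == Some a)%:R : R).
Proof.
have := @edge_coord_continuous (true, a).
by under eq_fun do rewrite /l2_coord edge_vecE.
Qed.

Lemma proj2e_continuous a :
  continuous (fun x : K => (proj2e x == Some a)%:R : R).
Proof.
have := @edge_coord_continuous (false, a).
by under eq_fun do rewrite /l2_coord edge_vecE.
Qed.

End moebius.

(** * Embedding c_0 into l_infty/c_0 *)

(* The dyadic code of the first [k] digits of [x], preceded by a leading 1, so
   that distinct branches share finitely many codes. *)
Fixpoint branch (x : nat -> bool) (k : nat) : nat :=
  if k is k'.+1 then ((branch x k').*2 + x k')%N else 1%N.

Lemma branch_gt x k : (k < branch x k)%N.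
Proof. by elim: k => //= k; case: (x k) => /=; lia. Qed.

Lemma branch_inj x y k l :
  branch x k = branch y l -> k = l /\ forall i, (i < k)%N -> x i = y i.
Proof.
elim: k l => [|k ih] [|l] //=.
- by have := branch_gt y l; lia.
- by have := branch_gt x k; lia.
(* The parity of a code is its last digit; removing it leaves the codes of the prefixes. *)
move=> E; have xy : x k = y l :> bool.
  by have := congr1 odd E; rewrite !oddD !odd_double /=; case: (x k);
    case: (y l).
have /ih[kl kxy] : branch x k = branch y l.
  by apply: double_inj; move: E; rewrite xy => /addIn.
split=> [|i]; first by rewrite kl.
by rewrite ltnS leq_eqVlt => /orP[/eqP->|/kxy//]; rewrite xy kl.
Qed.

Lemma leq_branch x k l : (k <= l)%N -> (branch x k <= branch x l)%N.
Proof.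
move=> /subnK <-; elim: (l - k)%N => //= m ih; rewrite (leq_trans ih)//.
by lia.
Qed.

Section c0_embedding.
Variables (R : realType) (X : Type) (enc : X -> nat -> bool).
Hypothesis enc_inj : injective enc.

(** The sets [thru x] are infinite and almost disjoint. *)
Definition thru (x : X) (n : nat) := exists k, n = branch (enc x) k.

Lemma thru_infinite x N : exists2 n, (N <= n)%N & thru x n.
Proof. by exists (branch (enc x) N); [exact/ltnW/branch_gt|exists N]. Qed.

Lemma thru_disjoint (S : set X) : finite_set S ->
  \forall n \near \oo, forall x, S x -> forall y, S y -> thru x n ->
    thru y n -> x = y.
Proof.
move=> fS; apply: (@finite_near_forall _ _ \oo S (fun x =>
  [set n | forall y, S y -> thru x n -> thru y n -> x = y])) => // x _.
apply: (@finite_near_forall _ _ \oo S (fun y =>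
  [set n | thru x n -> thru y n -> x = y])) => // y _.
have [->|xy] := pselect (x = y); first by exists 0%N.
have [j xyj] : exists j, enc x j <> enc y j.
  apply: contrapT => /forallNP H; apply/xy/enc_inj/funext => j.
  exact: contrapT (H j).
(* The branches differ at digit [j], so a common code uses at most [j] digits and is at most
   [branch (enc x) j]. *)
exists (branch (enc x) j).+1 => // n /= jn [k nk] [l nl].
have [kl /(_ j) kxy] := branch_inj (etrans (esym nk) nl).
have [jk|kj] := ltnP j k; first by case: (xyj (kxy jk)).
by move: jn; rewrite nk ltnNge leq_branch.
Qed.

(** Many branches may pass through [n], whence a supremum. The added 0 makes the set nonempty and
    yields the positive part. *)
Definition branch_sup (z : X -> R) (n : nat) : R :=
  sup ([set z x | x in thru ^~ n] `|` [set 0]).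

(** Positive part minus negative part: if a single branch through [n] carries a large value, the
    result is close to that value. It is linear in [z] only modulo c_0. *)
Definition branch_lift (z : X -> R) (n : nat) : R :=
  branch_sup z n - branch_sup (\- z) n.

Lemma branch_sup_le z n M : 0 <= M -> (forall x, thru x n -> z x <= M) ->
  branch_sup z n <= M.
Proof.
move=> M0 zM; apply: ge_sup; first by exists 0; right.
by move=> _ [[x /= xn <-]|->//]; exact: zM.
Qed.

Definition is_c0 (z : X -> R) :=
  forall e, 0 < e -> finite_set [set x | e <= `|z x|].

Lemma is_c0_bounded z : is_c0 z -> exists M, forall x, `|z x| <= M.
Proof.
move=> /(_ 1 ltr01) fS.
have : \forall M \near +oo%R, forall x, [set x | 1 <= `|z x|] x -> `|z x| <= M.
  apply: (@finite_near_forall _ _ +oo%R _ (fun x => [set M | `|z x| <= M])).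
    exact: fS.
  move=> x _.
  exact: nbhs_pinfty_ge.
move=> /(filterI (nbhs_pinfty_ge (@real1 R)))/filter_ex[M [/= M1 zM]].
exists M => x; have [/zM//|/ltW zx] := leP 1 `|z x|; exact: le_trans zx M1.
Qed.

Lemma is_c0P a z w : is_c0 z -> is_c0 w -> is_c0 (fun x => a * z x + w x).
Proof.
(* Chosen so that [|a| * d + d] is half of [e]; the summand 2 keeps the denominator positive. *)
move=> zc wc e e0; pose d := e / (2 * `|a| + 2).
have a0 : 0 < 2 * `|a| + 2 by rewrite ltr_wpDl// mulr_ge0.
have d0 : 0 < d by rewrite divr_gt0.
apply: (@sub_finite_set _ _ ([set x | d <= `|z x|] `|` [set x | d <= `|w x|])).
  move=> x /=; have [|zd] := leP d `|z x|; first by left.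
  have [|wd] := leP d `|w x|; first by right.
  rewrite leNgt => /negP[]; rewrite (le_lt_trans (ler_normD _ _))// normrM.
  rewrite (@le_lt_trans _ _ (`|a| * d + d))//.
    by rewrite lerD ?ler_wpM2l ?(ltW zd) ?(ltW wd).
  have -> : e = (`|a| * d + d) + (`|a| * d + d).
    by rewrite /d; field; rewrite gt_eqF.
  by rewrite ltrDl ltr_wpDl// mulr_ge0// ltW.
by rewrite finite_setU; split; [exact: zc|exact: wc].
Qed.

Section approx.
Variables (z : X -> R) (M : R).
Hypothesis zM : forall x, `|z x| <= M.

Lemma branch_sup_ub n : has_ubound ([set z x | x in thru ^~ n] `|` [set 0]).
Proof.
exists `|M| => _ [[x _ <-]|->//]; rewrite (le_trans (ler_norm _))//.
by rewrite (le_trans (zM x))// ler_norm.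
Qed.

Lemma branch_sup_ge0 n : 0 <= branch_sup z n.
Proof. by apply: (ub_le_sup (branch_sup_ub n)); right. Qed.

Lemma le_branch_sup n x : thru x n -> z x <= branch_sup z n.
Proof. by move=> xn; apply: (ub_le_sup (branch_sup_ub n)); left; exists x. Qed.

End approx.

Lemma branch_lift_le z n e : is_c0 z -> 0 <= e ->
  (forall x, thru x n -> `|z x| <= e) -> `|branch_lift z n| <= e.
Proof.
move=> /is_c0_bounded[M zM] e0 ze.
have nzM x : `|(\- z) x| <= M by rewrite normrN.
have p0 := branch_sup_ge0 zM n; have n0 := branch_sup_ge0 nzM n.
have pe : branch_sup z n <= e.
  by apply: branch_sup_le => // x /ze; exact: le_trans (ler_norm _).
have ne : branch_sup (\- z) n <= e.
  by apply: branch_sup_le => // x /ze; rewrite -normrN;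
    exact: le_trans (ler_norm _).
by rewrite ler_norml /branch_lift; apply/andP; split; lra.
Qed.

(** [branch_sup z n] lies between the positive part of [z x] and the maximum of [z x] and [e], and
    likewise for [- z]; subtracting leaves an error of at most [e]. *)
Lemma branch_lift_dist z n e x : is_c0 z -> 0 <= e -> thru x n ->
  (forall y, thru y n -> y <> x -> `|z y| <= e) ->
    `|branch_lift z n - z x| <= e.
Proof.
move=> /is_c0_bounded[M zM] e0 xn ze.
have nzM y : `|(\- z) y| <= M by rewrite normrN.
have p0 := branch_sup_ge0 zM n; have n0 := branch_sup_ge0 nzM n.
have px := le_branch_sup zM xn; have /= nx := le_branch_sup nzM xn.
have pe : branch_sup z n <= Num.max (z x) e.
  apply: branch_sup_le => [|y yn]; first by rewrite le_max e0 orbT.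
  rewrite le_max; have [->|yx] := pselect (y = x); first by rewrite lexx.
  by rewrite (le_trans (ler_norm _) (ze y yn yx)) orbT.
have ne : branch_sup (\- z) n <= Num.max (- z x) e.
  apply: branch_sup_le => [|y yn]; first by rewrite le_max e0 orbT.
  rewrite le_max; have [->|yx] := pselect (y = x); first by rewrite lexx.
  by rewrite [X in _ || X](le_trans (ler_norm (- z y))) ?orbT// normrN ze.
rewrite ler_norml /branch_lift.
move: pe ne; have [zxe|zxe] := leP (z x) e;
  have [nzxe|nzxe] := leP (- z x) e => pe ne;
  by apply/andP; split; lra.
Qed.

Lemma branch_lift_bounded z : is_c0 z -> branch_lift z \in @bounded_pred R.
Proof.
move=> zc; have [M zM] := is_c0_bounded zc; apply/bounded_predP;
  exists `|M| => n.
apply: branch_lift_le => // x _.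
by rewrite (le_trans (zM x))// ler_norm.
Qed.

Definition c0_class (z : X -> R) (zc : is_c0 z) : linf_c0 R :=
  linf_c0_class (Linf (branch_lift_bounded zc)).

Lemma c0_class_norm z (zc : is_c0 z) :
  `|c0_class zc| = limsup_norm (Linf (branch_lift_bounded zc)).
Proof. exact: linf_c0_normE. Qed.

(** Outside a finite set [S] both functions are small. For large [n] at most one point [x] of [S]
    has its branch through [n]: all three lifts are then close to the values at [x], where the
    linear relation is exact. If there is none, all three are small. *)
Lemma c0_class_linear a z w (zc : is_c0 z) (wc : is_c0 w)
    (c : is_c0 (fun x => a * z x + w x)) :
  c0_class c = a *: c0_class zc + c0_class wc.
Proof.
rewrite /c0_class -linearP; apply/linf_c0_classP/c0_predP/cvgr0Pnorm_le => e e0.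
pose d := e / (2 * `|a| + 2).
have a0 : 0 < 2 * `|a| + 2 by rewrite ltr_wpDl// mulr_ge0.
have d0 : 0 < d by rewrite divr_gt0.
have eE : e = (`|a| * d + d) + `|a| * d + d.
  by rewrite /d; field; rewrite gt_eqF.
pose S := [set x | d <= `|z x|] `|` [set x | d <= `|w x|].
have fS : finite_set S by rewrite finite_setU; split; [exact: zc|exact: wc].
have small_le y : ~ S y -> `|z y| <= d /\ `|w y| <= d.
  by move=> nS; split; apply/ltW; rewrite ltNge; apply/negP => yd; apply: nS;
    [left|right].
apply: filterS (thru_disjoint fS) => n Sn.
rewrite [X in `|X|](_ : _ = branch_lift (fun x => a * z x + w x) n
   - (a * branch_lift z n + branch_lift w n))//.
have zwd y : `|z y| <= d -> `|w y| <= d -> `|a * z y + w y| <= `|a| * d + d.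
  move=> zy wy; rewrite (le_trans (ler_normD _ _))// lerD// normrM.
  by rewrite ler_wpM2l.
have ad0 : 0 <= `|a| * d by rewrite mulr_ge0// ltW.
have split_le (p q r : R) : `|p| <= `|a| * d + d -> `|q| <= d -> `|r| <= d ->
    `|p - a * q - r| <= e.
  move=> pe qe re; rewrite {}[e]eE (le_trans (ler_normB _ _))// lerD//.
  by rewrite (le_trans (ler_normB _ _))// lerD// normrM ler_wpM2l.
have [[x [xn Sx]]|nS] := pselect (exists x, thru x n /\ S x).
  have small y : thru y n -> y <> x -> `|z y| <= d /\ `|w y| <= d.
    by move=> yn yx; apply: small_le => Sy; apply: yx; exact: Sn.
  rewrite (_ :
    _ - _ = (branch_lift (fun x => a * z x + w x) n - (a * z x + w x))
     - a * (branch_lift z n - z x) - (branch_lift w n - w x)); last by ring.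
  apply: split_le.
  - apply: (@branch_lift_dist (fun x => a * z x + w x)) => // [|y yn yx].
      by rewrite addr_ge0// ltW.
    by have [] := small y yn yx; exact: zwd.
  - by apply: branch_lift_dist; rewrite ?(ltW d0)// => y yn /(small _ yn)[].
  - by apply: branch_lift_dist; rewrite ?(ltW d0)// => y yn /(small _ yn)[].
have small y : thru y n -> `|z y| <= d /\ `|w y| <= d.
  by move=> yn; apply: small_le => Sy; apply: nS; exists y.
rewrite opprD addrA; apply: split_le.
- apply: branch_lift_le => // [|y yn]; first by rewrite addr_ge0// ltW.
  by have [] := small y yn; exact: zwd.
- by apply: branch_lift_le; rewrite ?(ltW d0)// => y /small[].
- by apply: branch_lift_le; rewrite ?(ltW d0)// => y /small[].
Qed.

Lemma c0_class_norm_le z (zc : is_c0 z) M : 0 <= M ->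
  (forall x, `|z x| <= M) -> `|c0_class zc| <= M.
Proof.
move=> M0 zM; rewrite c0_class_norm; apply: limsup_norm_le.
by apply: nearW => n; apply: branch_lift_le.
Qed.

Lemma c0_class_norm_ge z (zc : is_c0 z) x : `|z x| <= `|c0_class zc|.
Proof.
rewrite c0_class_norm; set l := limsup_norm _.
apply/ler_addgt0Pr => e e0; have e20 : 0 < e / 2 by rewrite divr_gt0.
(* Including [x] separates its branch from those of all points with large values; far along this
   branch the lift is within [e / 2] of [z x]. *)
have fS : finite_set ([set x] `|` [set y | e / 2 <= `|z y|]).
  by rewrite finite_setU; split; [exact: finite_set1|exact: (zc _ e20)].
have : l < l + e / 2 by rewrite ltrDl.
move=> /limsup_norm_lt; set L := Linf _ => Ll.
have [N _ H] := filterI (thru_disjoint fS) Ll.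
have [n Nn xn] := thru_infinite x N; have [/= Sn ln] := H n Nn.
have : `|branch_lift z n - z x| <= e / 2.
  apply: branch_lift_dist => // [|y yn yx]; first exact: ltW.
  apply/ltW; rewrite ltNge; apply/negP => yd; apply: yx.
  by apply: Sn => //; [right|left].
rewrite distrC => xe.
rewrite -(subrK (branch_lift z n) (z x)) (le_trans (ler_normD _ _))//.
by rewrite [e in leRHS]splitr addrA addrC lerD// ltW.
Qed.

End c0_embedding.

(** * Embeddings of C(K) *)

Lemma bounded_below_embedding (R : realType) (X Y : normedModType R)
    (T : {linear X -> Y}) (C : R) : 0 < C ->
  (forall x, `|T x| <= C * `|x|) -> (forall x, `|x| <= C * `|T x|) ->
  topological_embedding T.
Proof.
move=> C0 TC CT; split.
- move=> x y xy; apply/eqP; rewrite -subr_eq0 -normr_le0.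
  by rewrite (le_trans (CT _))// linearB xy subrr normr0 mulr0.
- apply/linear_bounded_continuous/linear_boundedP; exists C; split => [|r Cr x].
    exact: gtr0_real.
  by rewrite (le_trans (TC x))// ler_wpM2r// ltW.
move=> U oU.
have /choice[r rP] : forall x, exists r, U x -> 0 < r /\ ball x r `<=` U.
  move=> x; have [Ux|nUx] := pselect (U x); last by exists 0.
  have : nbhs x U by exact: open_nbhs_nbhs.
  by move=> /nbhs_ballP[r r0 rU]; exists r.
(* Since [T] shrinks distances by at most the factor [C], images within [r x / C] come from points
   within [r x]. *)
apply/open_subspaceP; exists (\bigcup_(x in U) ball (T x) (r x / C)).
  apply: bigcup_open => x Ux; exact: ball_open.
apply/seteqP; split=> z [].
  move=> [x Ux xz] [y _ yz]; split; exists y => //.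
  have [r0 rU] := rP x Ux; apply: rU; move: xz.
  rewrite -yz -!ball_normE/= -linearB ltr_pdivlMr// mulrC.
  exact: le_lt_trans (CT _).
move=> [x Ux xz] rz; split=> //; exists x => //; rewrite -xz.
by apply: ballxx; rewrite divr_gt0//; have [] := rP x Ux.
Qed.

Section branch_code.
Variable A : set ((nat -> bool) * (nat -> bool)).

(** The first digit marks [Some]. Interleaving two such codes assigns distinct branches to the
    points of K, which is how the bound of K by the continuum enters. *)
Definition option_code (o : option (nat -> bool)) (n : nat) : bool :=
  if o is Some a then (if n is n'.+1 then a n' else true) else false.

Definition edge_code (x : edges A) (n : nat) : bool :=
  option_code (if odd n then proj2e x else proj1e x) n./2.

Lemma option_code_inj : injective option_code.
Proof.
move=> [a|] [b|] // E; try by have := congr1 (fun f => f 0%N) E.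
by congr Some; apply/funext => n; exact: (congr1 (fun f => f n.+1) E).
Qed.

Lemma edge_code_inj : injective edge_code.
Proof.
move=> x y E; apply: val_inj.
rewrite [LHS]surjective_pairing [RHS]surjective_pairing; congr (_, _).
  apply: option_code_inj; apply/funext => n; have := congr1 (fun f => f n.*2) E.
  by rewrite /edge_code odd_double doubleK.
apply: option_code_inj; apply/funext => n;
  have := congr1 (fun f => f n.*2.+1) E.
by rewrite /edge_code /= odd_double uphalf_double.
Qed.

End branch_code.

(** * The isomorphic embedding *)

Section isomorphic_embedding.
Variables (R : realType) (A : set ((nat -> bool) * (nat -> bool))).
Local Notation K := (edge_space R A).
Local Notation cK := (@edge_space_compact R _ A).
Local Notation enc := (@edge_code A).

Lemma cfun_moebius_c0 (f : CK R cK) : is_c0 (moebius (f : K -> R)).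
Proof. by move=> e; apply: moebius_c0; exact: cfun_continuous f. Qed.

Definition CK_to_linf_c0 (f : CK R cK) : linf_c0 R :=
  c0_class enc (cfun_moebius_c0 f).

Lemma c0_class_ext (z w : edges A -> R) (zc : is_c0 z) (wc : is_c0 w) :
  z = w -> c0_class enc zc = c0_class enc wc.
Proof. by move=> zw; subst w; congr c0_class; exact: Prop_irrelevance. Qed.

Lemma CK_to_linf_c0_linear : linear CK_to_linf_c0.
Proof.
move=> a f g; rewrite /CK_to_linf_c0.
have c := is_c0P a (cfun_moebius_c0 f) (cfun_moebius_c0 g).
rewrite -(c0_class_linear (@edge_code_inj A) _ _ c); apply: c0_class_ext.
by apply/funext => x; rewrite -moebiusP.
Qed.

HB.instance Definition _ := GRing.isLinear.Build R (CK R cK) (linf_c0 R) _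
  CK_to_linf_c0 CK_to_linf_c0_linear.

Lemma edge_space_isomorphically_embeds :
  isomorphically_embeds (CK R cK) (linf_c0 R).
Proof.
(* The Moebius transform and its inverse each cost a factor of at most 4; the passage from c_0(K) to
   classes is isometric. *)
exists CK_to_linf_c0; apply: (@bounded_below_embedding _ _ _ _ 4) => // f.
  apply: c0_class_norm_le => [|x]; first by rewrite mulr_ge0.
  by apply: moebius_le => y; exact: sup_norm_ub.
apply: sup_norm_le => [|x]; first by rewrite mulr_ge0.
apply: moebius_inv_le => y.
exact: (c0_class_norm_ge (@edge_code_inj A) (cfun_moebius_c0 f)).
Qed.

End isomorphic_embedding.

(** * An isometric embedding puts A in P^2 *)

Lemma square_sigma_field_limsup (R : realType) (T : pointedType)
    (u v : T -> nat -> R) (c : R) :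
  square_sigma_field [set p : T * T | forall N, exists2 n, (N <= n)%N &
    c < `|u p.1 n + v p.2 n| ].
Proof.
pose rect := [set A1 `*` A2 | A1 in [set: set T] & A2 in [set: set T]].
pose M := g_sigma_algebraType rect.
(* Each summand depends on one coordinate, so its preimages are rectangles with one full side; the
   other side may be an arbitrary subset of [T]. *)
have mf n : measurable_fun [set: M] (fun p : M => `|u p.1 n + v p.2 n|).
  apply: measurableT_comp => //; apply: measurable_funD.
    move=> _ Y _; rewrite setTI; apply: sub_sigma_algebra.
    exists [set a | Y (u a n)] => //; exists setT => //.
    by apply/seteqP; split => p //= -[].
  move=> _ Y _; rewrite setTI; apply: sub_sigma_algebra.
  exists setT => //; exists [set a | Y (v a n)] => //.
  by apply/seteqP; split => p //= -[].
have mS n : measurable ([set p | c < `|u p.1 n + v p.2 n|] : set M).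
  have := mf n measurableT _ (measurable_itv `]c, +oo[).
  by rewrite setTI; congr measurable; apply/funext => p /=;
    rewrite in_itv/= andbT.
have : measurable (\bigcap_N \bigcup_(n in [set n | (N <= n)%N])
    ([set p | c < `|u p.1 n + v p.2 n|] : set M)).
  by apply: bigcapT_measurable => N; apply: bigcup_measurable.
congr measurable; apply/seteqP; split=> p.
  by move=> H N; have [n Nn cn] := H N I; exists n.
by move=> H N _; have [n Nn cn] := H N; exists n.
Qed.

Section isometric_embedding.
Variables (R : realType) (T : pointedType) (A : set (T * T)).
Local Notation K := (edge_space R A).
Local Notation cK := (@edge_space_compact R _ A).

Definition CK_of (f : K -> R) (fc : continuous f) : CK R cK :=
  CFun (mem_set fc : f \in @continuous_pred R K).

Definition indic1 (a : T) : CK R cK := CK_of (@proj1e_continuous R T A a).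
Definition indic2 (b : T) : CK R cK := CK_of (@proj2e_continuous R T A b).

Lemma indicDE a b (x : K) :
  (indic1 a + indic2 b) x = (proj1e x == Some a)%:R + (proj2e x == Some b)%:R.
Proof. by []. Qed.

Lemma norm_indicD_edge a b : A (a, b) -> 2 <= `|indic1 a + indic2 b|.
Proof.
move=> Aab; have p : edge_pred A (Some a, Some b) by apply/asboolP.
have :=
  sup_norm_ub (indic1 a + indic2 b) (exist _ (Some a, Some b) p : edges A).
by rewrite indicDE !eqxx ger0_norm.
Qed.

Lemma norm_indicD_nonedge a b : ~ A (a, b) -> `|indic1 a + indic2 b| <= 1.
Proof.
move=> nAab; apply: sup_norm_le => // x; rewrite indicDE.
case: eqP => [x1|_]; case: eqP => [x2|_];
  rewrite ?addr0 ?add0r ?normr0 ?normr1//.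
exfalso; apply: nAab; have := valP x.
by rewrite [val x]surjective_pairing -/(proj1e x) -/(proj2e x) x1 x2 =>
  /asboolP.
Qed.

Lemma isometrically_embeds_square_sigma_field :
  isometrically_embeds (CK R cK) (linf_c0 R) -> square_sigma_field A.
Proof.
move=> [S SE]; pose u a := repr (S (indic1 a)); pose v b := repr (S (indic2 b)).
have uvE a b : limsup_norm (u a + v b) = `|indic1 a + indic2 b|.
  by rewrite -linf_c0_normE linf_c0_classD !linf_c0_reprK -linearD; exact: SE.
(* Any threshold strictly between the norms 1 and 2 works: strictness on both sides makes infinitely
   many exceedances equivalent to being an edge. *)
have := @square_sigma_field_limsup R T u v (3 / 2).
congr square_sigma_field; apply/seteqP; split => -[a b] /= H.
  apply: contrapT => /norm_indicD_nonedge; rewrite -uvE => le1.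
  have /limsup_norm_lt[N _ HN] : limsup_norm (u a + v b) < 3 / 2.
    by rewrite (le_lt_trans le1)//; lra.
  by have [n /HN] := H N; rewrite ltNge => /negP + /ltW.
move=> N; apply: contrapT => HN; have := norm_indicD_edge H; apply/negP.
rewrite -ltNge -uvE (@le_lt_trans _ _ (3 / 2))//; last by lra.
apply: limsup_norm_le; exists N => // n /= Nn; rewrite leNgt; apply/negP => cn.
by apply: HN; exists n.
Qed.

End isometric_embedding.

Theorem theorem3p5 (R : realType) :
  ~ kunen (nat -> bool) ->
  exists (K : topologicalType) (cK : compact [set: K]),
    [/\ uniform_eberlein R K,
        isomorphically_embeds (CK R cK) (linf_c0 R) &
        ~ isometrically_embeds (CK R cK) (linf_c0 R)].
Proof.
move=> /existsNP[A nA].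
exists (edge_space R A), (@edge_space_compact R _ A); split.
- exact: edge_space_uniform_eberlein.
- exact: edge_space_isomorphically_embeds.
by move=> /isometrically_embeds_square_sigma_field.
Qed.
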